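(* Assume that $X_M\subset X_N$ is unisolvent for $\Pi_m(\mathbb{S}^2)$ and that the sampling set $X_N$ satisfies, for a constant $\alpha_r>0$, $$\frac1N\sum_{\boldsymbol{x}_i\in X_N}|p(\boldsymbol{x}_i)|^2\ \ge\ \alpha_r\|p\|_{L^2(\mathbb{S}^2)}^2\qquad\text{for all } p\in\Pi_r(\mathbb{S}^2).$$ Then, for any $f\in C(\mathbb{S}^2)$, the following statements hold. (a) The polynomial $\hat p_r[f]-p_m[f]$ satisfies $$\left\langle (f-p_m[f])-(\hat p_r[f]-p_m[f]),\,q\right\rangle_{X_N}=0\qquad\text{for all } q\in\mathcal{V}_{r,M}.$$ (b) The following Pythagorean identity holds: $$\|f-\hat p_r[f]\|_{2,X_N}^2+\|\hat p_r[f]-p_m[f]\|_{2,X_N}^2=\|f-p_m[f]\|_{2,X_N}^2.$$ (c) The interpolation--regression approximant satisfies $$\|f-\hat p_r[f]\|_{L^2(\mathbb{S}^2)}\le\left(\sqrt{4\pi}+\frac1{\sqrt{\alpha_r}}\right)(1+\Lambda_M)\inf_{q\in\Pi_m(\mathbb{S}^2)}\|f-q\|_{L^\infty(\mathbb{S}^2)}.$$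
   Context: $\Pi_r(\mathbb{S}^2)$ is the space of spherical polynomials of degree at most $r$ on the unit sphere $\mathbb{S}^2\subset\mathbb{R}^3$, of dimension $(r+1)^2$. $L^2(\mathbb{S}^2)$ is taken with respect to the surface measure $d\omega$ (total mass $4\pi$). $X_N=\{\boldsymbol{x}_1,\dots,\boldsymbol{x}_N\}\subset\mathbb{S}^2$ is a set of $N$ distinct sampling nodes and $X_M=\{\boldsymbol{x}_1',\dots,\boldsymbol{x}_M'\}\subset X_N$ a subset of $M$ distinct interpolation nodes. Conventions: $N=(n+1)^2$, $M=(m+1)^2=\dim\Pi_m(\mathbb{S}^2)$, with integers $0\le m<r<n$. $X_M$ is unisolvent for $\Pi_m(\mathbb{S}^2)$ if for every $g\in C(\mathbb{S}^2)$ there is a unique $p_m[g]\in\Pi_m(\mathbb{S}^2)$ with $p_m[g](\boldsymbol{x}_j')=g(\boldsymbol{x}_j')$, $j=1,\dots,M$. Let $\ell_j\in\Pi_m(\mathbb{S}^2)$ be the Lagrange basis, $\ell_j(\boldsymbol{x}_k')=\delta_{jk}$; the Lebesgue constant is $\Lambda_M=\sup_{\boldsymbol{x}\in\mathbb{S}^2}\sum_{j=1}^M|\ell_j(\boldsymbol{x})|$. For $f:\mathbb{S}^2\to\mathbb{R}$, the interpolation--regression approximant $\hat p_r[f]$ is the unique minimizer of $\sum_{i=1}^N|p(\boldsymbol{x}_i)-f(\boldsymbol{x}_i)|^2$ over all $p\in\Pi_r(\mathbb{S}^2)$ subject to $p(\boldsymbol{x}_j')=f(\boldsymbol{x}_j')$,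 $j=1,\dots,M$. (Uniqueness holds when the Vandermonde matrices of a basis of $\Pi_r(\mathbb{S}^2)$ at $X_N$ and at $X_M$ have ranks $(r+1)^2$ and $M$ respectively, which is the case under the hypotheses here.) Notation: $\langle p,q\rangle_{X_N}=\sum_{i=1}^N p(\boldsymbol{x}_i)q(\boldsymbol{x}_i)$, $\|h\|_{2,X_N}=\left(\sum_{i=1}^N|h(\boldsymbol{x}_i)|^2\right)^{1/2}$, $\mathcal{V}_{r,M}=\{q\in\Pi_r(\mathbb{S}^2): q(\boldsymbol{x}_j')=0,\ j=1,\dots,M\}$. *)

(* Defs.v *)
From HB Require Import structures.
From mathcomp Require Import all_boot all_order all_algebra.
From mathcomp Require Import all_classical all_reals all_analysis.
From mathcomp Require Import measurable_realfun.
From mathcomp Require mpoly.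

(* Importing the notations of mpoly would clash with those of the analysis library *)
Import (canonicals, coercions, hints) mpoly.

Set Implicit Arguments.
Unset Strict Implicit.
Unset Printing Implicit Defensive.

Import Order.TTheory GRing.Theory Num.Theory.
Import numFieldNormedType.Exports.

Local Open Scope classical_set_scope.
Local Open Scope ring_scope.

Definition sphere_set (R : realType) : set 'rV[R]_3 :=
  [set x | \sum_(i < 3) x 0 i ^+ 2 = 1].

(* The topology is the one induced by R^3, the sigma-algebra is the Borel one *)
Definition sphere (R : realType) : Type := set_type (@sphere_set R).

(* R^2 with the sigma-algebra on which the Lebesgue product measure lives *)
Notation plane R := (measurableTypeR R * measurableTypeR R)%type.

Section sphere_instances.
Variable R : realType.

Definition spherical_coord_row (u : plane R) : 'rV[R]_3 :=
  \row_(i < 3) [:: sin u.1 * cos u.2; sin u.1 * sin u.2; cos u.1]`_i.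

Lemma spherical_coord_subproof (u : plane R) :
  spherical_coord_row u \in @sphere_set R.
Proof.
rewrite inE /sphere_set /= !big_ord_recl big_ord0 !mxE /=.
by rewrite addr0 !exprMn addrA -mulrDr cos2Dsin2 mulr1 addrC cos2Dsin2.
Qed.

(* u = (polar angle, azimuth) *)
Definition spherical_coord (u : plane R) : sphere R :=
  exist _ (spherical_coord_row u) (spherical_coord_subproof u).

HB.instance Definition _ := Choice.copy (sphere R) (set_type (@sphere_set R)).
HB.instance Definition _ :=
  Topological.copy (sphere R) (set_type (@sphere_set R)).
HB.instance Definition _ := isPointed.Build (sphere R) (spherical_coord (0, 0)).
HB.instance Definition _ :=
  @isMeasurable.Build (sigma_display (@open (sphere R))) (sphere R)
    <<s @open (sphere R) >> (@sigma_algebra0 _ setT _)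
    (@sigma_algebraC (sphere R) _) (@sigma_algebra_bigcup _ setT _).

Lemma continuous_spherical_coord :
  continuous (spherical_coord : R * R -> sphere R).
Proof.
apply: continuous_comp_initial => u A [P Pu PA].
have c1 (g : R -> R) : continuous g -> (g v.1 @[v --> u] --> g u.1).
  by move=> cg; apply: (@continuous_comp _ _ _ fst g); [exact: cvg_fst|exact: cg].
have c2 (g : R -> R) : continuous g -> (g v.2 @[v --> u] --> g u.2).
  by move=> cg; apply: (@continuous_comp _ _ _ snd g); [exact: cvg_snd|exact: cg].
have sin1 := c1 _ (@continuous_sin R); have cos1 := c1 _ (@continuous_cos R).
have sin2 := c2 _ (@continuous_sin R); have cos2 := c2 _ (@continuous_cos R).
have cvgP (j : 'I_3) : nbhs (u : R * R) (fun v => P 0 j (spherical_coord_row v 0 j)).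
  have Pj := Pu 0 j; move: Pj; rewrite set_valE /= mxE => Pj.
  suff : [:: sin v.1 * cos v.2; sin v.1 * sin v.2; cos v.1]`_j @[v --> u] -->
      [:: sin u.1 * cos u.2; sin u.1 * sin u.2; cos u.1]`_j.
    move=> /(_ _ Pj); congr (nbhs u _).
    by apply/funext => v; rewrite /= mxE.
  by case: j {Pj} => -[|[|[|//]]] /= _; [exact: cvgM|exact: cvgM|].
have fu : Filter (nbhs (u : R * R)) by exact: nbhs_filter.
have := @filter_forall _ _ _ _ fu cvgP.
by apply: (@filterS _ _ fu) => v Pv; apply: PA => i j; rewrite (ord1 i); exact: Pv.
Qed.

Lemma open_measurable_plane (U : set (plane R)) :
  open (U : set (R * R)) -> measurable U.
Proof.
move=> oU.
pose box (q : rat * rat * rat * rat) : set (plane R) :=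
  `](ratr q.1.1.1), (ratr q.1.1.2)[%classic `*` `](ratr q.1.2), (ratr q.2)[%classic.
have mbox q : measurable (box q).
  by apply: measurableX; exact: measurable_itv.
have box_sub (x : R) (P : set R) : nbhs x P -> exists a b : rat,
    ratr a < x < ratr b /\ (forall y, ratr a < y < ratr b -> P y).
  rewrite -nbhs_ballE => -[e /= e0 eP].
  have /rat_in_itvoo[a axe] : x - e < x by rewrite ltrBlDr ltrDl.
  have /rat_in_itvoo[b bxe] : x < x + e by rewrite ltrDl.
  exists a, b; rewrite !in_itv /= in axe bxe *.
  case/andP: axe => ea ax; case/andP: bxe => xb be.
  split; first by rewrite ax xb.
  move=> y /andP[ay yb]; apply: eP.
  rewrite /ball /= ltr_distlC (lt_trans ea ay) /=.
  exact: lt_trans yb be.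
rewrite (_ : U = \bigcup_q [set u | box q u /\ box q `<=` U]); last first.
  apply/seteqP; split => [[x y] Uxy|u [q _ [qu qU]]]; last exact: qU.
  have [[P Q] /= [Px Qy] PQU] : nbhs ((x, y) : R * R) U.
    exact: open_nbhs_nbhs.
  have [a [b [xab abP]]] := box_sub _ _ Px.
  have [c [d [ycd cdQ]]] := box_sub _ _ Qy.
  exists (a, b, c, d) => //; split=> [|[x' y']].
    by split; rewrite /= in_itv.
  rewrite /box /= => -[/=]; rewrite !in_itv /= => x'ab y'cd.
  by apply: PQU; split; [exact: abP|exact: cdQ].
apply: countable_bigcupT_measurable => // q.
have [qU|qU] := pselect (box q `<=` U).
  rewrite (_ : [set _ | _] = box q) //.
  by apply/seteqP; split => [u []|u].
rewrite (_ : [set _ | _] = set0) //.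
by apply/seteqP; split => [u []|u].
Qed.

Lemma measurable_spherical_coord : measurable_fun setT spherical_coord.
Proof.
apply: (measurability (@open (sphere R))) => //.
move=> _ [U oU <-]; rewrite setTI; apply: open_measurable_plane.
by move/continuousP : continuous_spherical_coord; apply.
Qed.

Definition angles : set (plane R) := `[0, pi] `*` `[0, 2 * pi].

(* dω = sin θ dθ dφ *)
Definition surface_measure (A : set (sphere R)) : \bar R :=
  (\int[(@lebesgue_measure R \x @lebesgue_measure R)%E]_(u in
     angles `&` spherical_coord @^-1` A) (sin u.1)%:E)%E.

Let surface0 : surface_measure set0 = 0%E.
Proof. by rewrite /surface_measure preimage_set0 setI0 integral_set0. Qed.

Let sin_angles (u : plane R) : angles u -> (0 <= (sin u.1)%:E)%E.
Proof. by case=> /=; rewrite in_itv /= lee_fin => /sin_ge0_pi. Qed.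

Let surface_ge0 A : (0 <= surface_measure A)%E.
Proof. by apply: integral_ge0 => u [/sin_angles]. Qed.

Let surface_sigma_additive : semi_sigma_additive surface_measure.
Proof.
move=> F mF tF mUF; rewrite /surface_measure; apply: cvg_toP.
  apply: ereal_nondecreasing_is_cvgn => m n mn.
  by apply: lee_sum_nneg_natr => // k _ _; exact: surface_ge0.
rewrite preimage_bigcup setI_bigcupr ge0_integral_bigcup//=.
- move=> k; apply: measurableI.
    by apply: measurableX; exact: measurable_itv.
  by rewrite -[X in measurable X]setTI; exact: measurable_spherical_coord.
- apply: (@measurable_funS _ _ (plane R) _ setT) => //.
  apply/measurable_EFinP.
  apply: (measurableT_comp (f := @sin R)); last exact: measurable_fst.
  by apply: continuous_measurable_fun; exact: continuous_sin.
- by move=> u [k _ [/sin_angles]].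
- apply/trivIsetP => i j _ _ ij; rewrite setIACA setIid -preimage_setI.
  by move/trivIsetP : tF => ->//; rewrite preimage_set0 setI0.
Qed.

HB.instance Definition _ := isMeasure.Build _ _ _ surface_measure
  surface0 surface_ge0 surface_sigma_additive.

End sphere_instances.

(* The unique element of P; a default value if P is not a singleton *)
Definition the (T : pointedType) (P : set T) : T := get [set x | unique P x].

Section approximation.
Variable R : realType.
Implicit Types (f h p q : sphere R -> R).

(* Restrictions to the sphere of polynomials in three variables of total degree
   at most r: msize is the total degree plus one (and 0 for the zero polynomial) *)
Definition sphere_poly (r : nat) : set (sphere R -> R) :=
  [set h | exists p : mpoly.mpoly 3 R, (mpoly.msize p <= r.+1)%N /\
     forall x : sphere R, h x = mpoly.meval (fun i => sval x 0 i) p].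

Definition L2norm h : \bar R := 'N[@surface_measure R]_(2%:E)[EFin \o h].

Definition Linfnorm h : \bar R := 'N[@surface_measure R]_(+oo%E)[EFin \o h].

Section nodes.
Variables (K : nat) (xs : 'I_K -> sphere R).

Definition interpolates f p : Prop := forall j, p (xs j) = f (xs j).

Definition unisolvent (m : nat) : Prop :=
  forall g : sphere R -> R, continuous g ->
    exists! p, sphere_poly m p /\ interpolates g p.

Definition interpolant (m : nat) f : sphere R -> R :=
  the [set p | sphere_poly m p /\ interpolates f p].

Definition lagrange (m : nat) (j : 'I_K) : sphere R -> R :=
  the [set l | sphere_poly m l /\ forall k, l (xs k) = (j == k)%:R].

Definition lebesgue_constant (m : nat) : \bar R :=
  ereal_sup [set (\sum_(j < K) `|lagrange m j x|)%:E | x in [set: sphere R]].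

Definition vanishing_poly (r : nat) : set (sphere R -> R) :=
  [set q | sphere_poly r q /\ forall j, q (xs j) = 0].

Definition node_inner p q : R := \sum_(i < K) p (xs i) * q (xs i).

Definition node_norm h : R := Num.sqrt (\sum_(i < K) `|h (xs i)| ^+ 2).

End nodes.

Definition interpolation_regression (N M : nat) (xN : 'I_N -> sphere R)
    (xM : 'I_M -> sphere R) (r : nat) f : sphere R -> R :=
  the [set p | (sphere_poly r p /\ interpolates xM f p) /\
    forall q, sphere_poly r q -> interpolates xM f q ->
      \sum_(i < N) `|p (xN i) - f (xN i)| ^+ 2 <=
      \sum_(i < N) `|q (xN i) - f (xN i)| ^+ 2].

End approximation.

Arguments L2norm {R} h%_R.
Arguments Linfnorm {R} h%_R.

(* Main.v *)
(* Let p_0 be the interpolant p_m[f] plus the orthogonal projection of f - p_m[f] onto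
   the polynomials vanishing on X_M, for the inner product of the values at X_N. The
   sampling inequality makes this inner product definite on the polynomials of degree
   at most r, so Pythagoras shows that p_0 is the unique constrained minimizer, which
   gives (a) and (b).
   For (c), the surface measure has mass 4 pi and charges every nonempty open set, so
   e := ||f - q||_oo bounds f - q everywhere for each q of degree at most m. Since
   p_m[f] - q is the interpolant of f - q, |f - p_m[f]| <= (1 + Lambda) e everywhere.
   The triangle inequality through p_m[f] concludes, the second term being bounded by
   the sampling inequality and (b). *)

Require Import Defs.
From mathcomp Require Import all_boot all_order all_algebra.
From mathcomp Require Import all_classical all_reals all_analysis.
From mathcomp Require mpoly.
From mathcomp Require Import measurable_realfun ess_sup_inf.
Import (canonicals, coercions, hints) mpoly.
Import Order.TTheory GRing.Theory Num.Theory.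
Import numFieldNormedType.Exports.

Set Implicit Arguments.
Unset Strict Implicit.
Unset Printing Implicit Defensive.

Local Open Scope classical_set_scope.
Local Open Scope ring_scope.

(** * Orthogonal projection onto a subspace of row vectors *)

Lemma orthonormal_rows_basis (R : rcfType) (N : nat) (W : set 'rV[R]_N) :
  W 0 -> (forall a u v, W u -> W v -> W (u + a *: v)) ->
  exists k (A : 'M[R]_(k, N)), [/\ A *m A^T = 1%:M,
    forall u, W (u *m A) & forall v, W v -> v = v *m A^T *m A].
Proof.
move=> W0 Wlin.
(* A family k A has k <= N, so one of maximal size exists; it spans W, since
   otherwise the normalised residual of some v in W could be appended to it. *)
pose family k (A : 'M[R]_(k, N)) := A *m A^T = 1%:M /\ forall u, W (u *m A).
have ex_family : exists k, `[< exists A : 'M[R]_(k, N), family k A >].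
  exists 0%N; apply/asboolP; exists 0; split=> [|u].
    by rewrite [LHS]flatmx0 [RHS]flatmx0.
  by rewrite mulmx0.
have family_le k : `[< exists A : 'M[R]_(k, N), family k A >] -> (k <= N)%N.
  move=> /asboolP[A [AA _]]; rewrite -(mxrank1 R k) -AA.
  exact: leq_trans (mxrankM_maxl _ _) (rank_leq_col _).
case: (ex_maxnP ex_family family_le) => k /asboolP[A [AA WA]] kmax.
exists k, A; split=> // v Wv.
apply/eqP; rewrite -subr_eq0; apply/negPn/negP => d0.
set d := v - _ in d0.
have Wd : W d by rewrite /d -scaleN1r; exact: Wlin.
have dA : d *m A^T = 0 by rewrite mulmxBl -!mulmxA AA mulmx1 subrr.
clearbody d; pose s := \sum_i d 0 i ^+ 2.
have s_gt0 : 0 < s.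
  have s_ge0 : 0 <= s by apply: sumr_ge0 => i _; exact: sqr_ge0.
  rewrite lt_neqAle s_ge0 andbT eq_sym psumr_eq0 => [|i _]; last exact: sqr_ge0.
  apply: contra d0 => /allP d0; apply/eqP/rowP => i; rewrite mxE.
  by have := d0 i (mem_index_enum _); rewrite sqrf_eq0 => /eqP.
have dd : d *m d^T = s%:M.
  by apply/rowP => i; rewrite (ord1 i) !mxE mulr1n; under eq_bigr do rewrite mxE -expr2.
pose e := (Num.sqrt s)^-1 *: d.
have ee : e *m e^T = 1%:M.
  rewrite /e linearZ /= -scalemxAl -scalemxAr scalerA dd scale_scalar_mx.
  by rewrite -invfM -expr2 sqr_sqrtr ?ltW// mulVf// gt_eqF.
have eA : e *m A^T = 0 by rewrite -scalemxAl dA scaler0.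
have Ae : A *m e^T = 0 by rewrite -[LHS]trmxK trmx_mul trmxK eA trmx0.
suff : (k + 1 <= k)%N by rewrite addn1 ltnn.
apply/kmax/asboolP; exists (col_mx A e); split=> [|u].
  by rewrite tr_col_mx mul_col_row AA ee eA Ae -scalar_mx_block.
rewrite -[u]hsubmxK mul_row_col [rsubmx u]mx11_scalar mul_scalar_mx.
by rewrite scalerA; exact: Wlin.
Qed.

(** With orthonormal rows [A] spanning [W], the projection is [g *m A^T *m A]: its residual is
    killed by [A^T], hence orthogonal to every [v = v *m A^T *m A]. *)
Lemma orthogonal_projection (R : rcfType) (N : nat) (W : set 'rV[R]_N) (g : 'rV[R]_N) :
  W 0 -> (forall a u v, W u -> W v -> W (u + a *: v)) ->
  exists2 w, W w & forall v, W v -> \sum_i (g - w) 0 i * v 0 i = 0.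
Proof.
move=> W0 /(orthonormal_rows_basis W0)[k [A [AA WA WE]]].
exists (g *m A^T *m A) => // v /WE vE.
have : (g - g *m A^T *m A) *m v^T = 0.
  have gA : (g - g *m A^T *m A) *m A^T = 0 by rewrite mulmxBl -!mulmxA AA mulmx1 subrr.
  by rewrite vE trmx_mul mulmxA gA mul0mx.
move/matrixP/(_ 0 0); rewrite mxE [RHS]mxE => gv; rewrite -[RHS]gv.
by apply: eq_bigr => i _; rewrite [v^T _ _]mxE.
Qed.

(** * Spherical coordinates, positivity and total mass of the surface measure *)

Lemma unit_circle_angle (R : realType) (x y : R) :
  x ^+ 2 + y ^+ 2 = 1 -> exists2 t, 0 <= t <= 2 * pi & cos t = x /\ sin t = y.
Proof.
move=> xy1.
have x1 : -1 <= x <= 1.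
  by rewrite -ler_norml -(expr_le1 (n := 2))// real_normK ?num_real// -xy1 lerDl sqr_ge0.
have x1i : x \in `[(-1 : R), 1] by rewrite in_itv.
have /andP[a0 api] : 0 <= acos x <= pi by rewrite acos_ge0// acos_lepi.
have sE : sin (acos x) = `|y| by rewrite sin_acos// -xy1 addrC addKr sqrtr_sqr.
(* The angle [acos x] has sine [|y|]; for negative [y] the reflected angle [2 * pi - acos x]
   corrects the sign. *)
have [y0|y0] := leP 0 y.
  exists (acos x); last by rewrite acosK// sE ger0_norm.
  by rewrite a0 (le_trans api)// ler_peMl ?pi_ge0// ler1n.
exists (2 * pi - acos x).
  rewrite subr_ge0 lerBlDr lerDl a0 andbT (le_trans api)// ler_peMl ?pi_ge0//.
  by rewrite ler1n.
rewrite cosB sinB mulr_natl cos2pi sin2pi !mul0r mul1r addr0 sub0r acosK//.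
by rewrite mul1r sE ltr0_norm// opprK.
Qed.

Lemma spherical_coord_surjective (R : realType) (x : sphere R) :
  exists2 u, angles u & spherical_coord u = x.
Proof.
case: x => v vS; have := vS; rewrite inE /sphere_set /= !big_ord_recl big_ord0 addr0.
set a := v 0 _; set b := v 0 _; set c := v 0 _ => abc.
pose s2 := a ^+ 2 + b ^+ 2.
have cE : c ^+ 2 = 1 - s2 by rewrite -abc addrA (addrC _ (c ^+ 2)) addrK.
have s2_ge0 : 0 <= s2 by rewrite addr_ge0 ?sqr_ge0.
have c1 : -1 <= c <= 1 by rewrite -ler_norml -(expr_le1 (n := 2))// real_normK ?num_real// cE gerBl.
have sinE : sin (acos c) = Num.sqrt s2 by rewrite sin_acos// cE opprB addrC subrK.
have cosE : cos (acos c) = c by rewrite acosK// in_itv.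
have [t t2 [ta tb]] : exists2 t, 0 <= t <= 2 * pi &
    Num.sqrt s2 * cos t = a /\ Num.sqrt s2 * sin t = b.
  (* At the poles [s2 = 0], the azimuth is arbitrary and 0 is taken; elsewhere [(a, b)] is rescaled
     to the unit circle. *)
  have [s20|s20] := eqVneq s2 0.
    have /andP[] : (a ^+ 2 == 0) && (b ^+ 2 == 0).
      by rewrite -paddr_eq0 ?sqr_ge0//; exact/eqP.
    rewrite !sqrf_eq0 => /eqP -> /eqP ->.
    exists 0; first by rewrite lexx mulr_ge0 ?pi_ge0.
    by rewrite s20 sqrtr0 !mul0r.
  have r0 : Num.sqrt s2 != 0 by rewrite sqrtr_eq0 -ltNge lt_neqAle eq_sym s20.
  have [|t t2 [ta tb]] := @unit_circle_angle R (a / Num.sqrt s2) (b / Num.sqrt s2).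
    by rewrite !expr_div_n sqr_sqrtr// -mulrDl divff.
  by exists t => //; rewrite ta tb ![_ * (_ / _)]mulrC !divfK.
exists (acos c, t).
  by split; rewrite /= in_itv //= acos_ge0// acos_lepi.
apply/val_inj/rowP => i; rewrite mxE /= sinE cosE ta tb.
by case: i => -[|[|[|//]]] i3 /=; congr (v 0 _); exact/val_inj.
Qed.

(* The point may be an endpoint (a pole of the sphere, where sin vanishes), hence
   the passage to a nearby open interval of interior points. *)
Lemma nbhs_itvcc_subitvoo (R : realType) (p t : R) (P : set R) :
  0 < p -> 0 <= t <= p -> nbhs t P ->
  exists a b, a < b /\ forall y, a < y < b -> 0 < y < p /\ P y.
Proof.
move=> p0 /andP[t0 tp]; rewrite -nbhs_ballE => -[e /= e0 eP].
exists (Num.max 0 (t - e)), (Num.min p (t + e)); split.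
  have te : t - e < t < t + e by rewrite ltrBlDr !ltrDl e0.
  have /andP[te1 te2] := te.
  by rewrite lt_min !gt_max p0 (lt_le_trans te1 tp) (le_lt_trans t0 te2) (lt_trans te1).
move=> y; rewrite gt_max lt_min => /andP[/andP[y0 tey] /andP[yp yte]].
rewrite y0 yp; split=> //; apply: eP.
by rewrite /ball /= ltr_distlC tey yte.
Qed.

Lemma measurable_angles (R : realType) : measurable (@angles R).
Proof. by apply: measurableX; exact: measurable_itv. Qed.

Lemma measurable_sin_polar (R : realType) :
  measurable_fun setT (fun u : plane R => (sin u.1)%:E).
Proof.
apply/measurable_EFinP; apply: (measurableT_comp (f := @sin R)) => //.
by apply: continuous_measurable_fun; exact: continuous_sin.
Qed.

(** The preimage of [U] contains an open rectangle of angles, of positive area, on which the sine is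
    positive. If [U] had measure 0, the sine would vanish almost everywhere on that rectangle. *)
Lemma surface_measure_open_gt0 (R : realType) (U : set (sphere R)) :
  open U -> U !=set0 -> (0 < surface_measure U)%E.
Proof.
move=> oU [x Ux]; rewrite lt0e measure_ge0 andbT; apply/eqP => U0.
have [[t s] [/= tpi s2pi] tsx] := spherical_coord_surjective x.
have oV : open (@spherical_coord R @^-1` U : set (R * R)).
  by move/continuousP : (@continuous_spherical_coord R); apply.
have [[P Q] /= [Pt Qs] PQU] : nbhs ((t, s) : R * R) (@spherical_coord R @^-1` U).
  by apply: open_nbhs_nbhs; split=> //; rewrite /preimage /= tsx.
have [a [b [ab abP]]] := nbhs_itvcc_subitvoo (pi_gt0 R) tpi Pt.
have [|c [d [cd cdQ]]] := nbhs_itvcc_subitvoo _ s2pi Qs.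
  by rewrite mulr_gt0 ?pi_gt0.
pose E : set (plane R) := `]a, b[%classic `*` `]c, d[%classic.
have mE : measurable E by apply: measurableX; exact: measurable_itv.
have EU u : E u -> (@angles R `&` @spherical_coord R @^-1` U) u /\ 0 < sin u.1.
  case=> /=; rewrite !in_itv /= => /abP[u1 Pu] /cdQ[u2 Qu].
  split; last exact: sin_gt0_pi.
  split; last by case: u u1 u2 Pu Qu => u1 u2 _ _ Pu Qu; exact: PQU.
  by case/andP: u1 => ? ?; case/andP: u2 => ? ?; split; rewrite /= in_itv /= !ltW.
have muE : (@lebesgue_measure R \x @lebesgue_measure R)%E E =
    ((b - a) * (d - c))%:E.
  transitivity (lebesgue_measure (`]a, b[%classic : set R) *
      lebesgue_measure (`]c, d[%classic : set R))%E.
    by apply: product_measure1E; exact: measurable_itv.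
  by rewrite !lebesgue_measure_itv /= !lte_fin ab cd.
suff : (@lebesgue_measure R \x @lebesgue_measure R)%E E = 0%E.
  by rewrite muE => -[] /eqP; rewrite mulf_eq0 !subr_eq0 !gt_eqF.
apply/negligibleP => //.
have mS : measurable (@angles R `&` @spherical_coord R @^-1` U).
  apply: measurableI; first exact: measurable_angles.
  by apply: open_measurable_plane.
have /(ae_eq_integral_abs _ mS (measurable_funTS (@measurable_sin_polar R))) :
    (\int[(@lebesgue_measure R \x @lebesgue_measure R)%E]_(u in
       @angles R `&` @spherical_coord R @^-1` U) `|(sin u.1)%:E| = 0)%E.
  rewrite -[RHS]U0; apply: eq_integral => u /set_mem[[/= u1 _] _].
  by rewrite /= ger0_norm// sin_ge0_pi// -in_itv.
apply: negligibleS => u /EU[Su su0] /= /(_ Su) -[] /eqP.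
by rewrite gt_eqF.
Qed.

(** Tonelli integrates out the azimuth, which leaves [2 * pi * sin x] on [[0, pi]], with primitive
    [- (2 * pi) * cos x]. *)
Lemma surface_measureT (R : realType) :
  surface_measure [set: sphere R] = (4 * pi)%:E.
Proof.
rewrite /surface_measure preimage_setT setIT integral_mkcond fubini_tonelli1; last 2 first.
- apply/(measurable_restrictT _ (@measurable_angles R)).
  exact: measurable_funTS (@measurable_sin_polar R).
- move=> u; rewrite patchE; case: ifPn => // /set_mem[/= u1 _].
  by rewrite lee_fin sin_ge0_pi// -in_itv.
have FE : fubini_F lebesgue_measure ((fun u : plane R => (sin u.1)%:E) \_ @angles R) =
    (fun x => (2 * pi * sin x)%:E) \_ `[0, pi].
  apply/funext => x; rewrite /fubini_F patchE.
  case: ifPn => [xpi|xpi].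
    rewrite (_ : (fun y => _) = (cst (sin x)%:E) \_ `[0, 2 * pi]).
      rewrite -integral_mkcond integral_cst; last exact: measurable_itv.
      transitivity ((sin x)%:E * lebesgue_measure (`[0, 2 * pi]%classic%R : set R))%E => //.
      rewrite lebesgue_measure_itv /= lte_fin mulr_gt0 ?pi_gt0// sube0.
      by rewrite -EFinM mulrC.
    apply/funext => y; rewrite !patchE; congr (if _ then _ else _).
    by rewrite in_setX xpi.
  rewrite (_ : (fun y => _) = cst 0%E) ?integral0//.
  by apply/funext => y; rewrite patchE in_setX (negbTE xpi).
have dF (x : R) : is_derive x 1 (fun x => - (2 * pi) * cos x) (2 * pi * sin x).
  rewrite (_ : 2 * pi * sin x = - (2 * pi) *: (- sin x)).
    exact: (is_deriveZ _ (is_derive_cos x)).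
  by rewrite scalerN scaleNr opprK.
have cF : continuous (fun x : R => - (2 * pi) * cos x).
  by move=> x; apply: cvgM; [exact: cvg_cst|exact: continuous_cos].
rewrite FE -integral_mkcond (@continuous_FTC2 _ _ (fun x => - (2 * pi) * cos x)).
- by rewrite cospi cos0 mulrN1 mulr1 -EFinB !opprK -mulrDl -natrD.
- exact: pi_gt0.
- apply: continuous_subspaceT => x; apply: cvgM; first exact: cvg_cst.
  exact: continuous_sin.
- split=> [x _||]; [|apply: cvg_at_right_filter|apply: cvg_at_left_filter].
  + exact: (@ex_derive _ _ _ _ _ _ _ (dF x)).
  + exact: cF.
  + exact: cF.
- by move=> x _; rewrite derive1E (@derive_val _ _ _ _ _ _ _ (dF x)).
Qed.

(** * Elements singled out by a unique characterisation *)

Lemma thePex (T : pointedType) (P : set T) : (exists! x, P x) -> P (the P).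
Proof.
move=> [x ux]; have : unique P (the P) by exact: (@getI _ [set x | unique P x] x).
by case.
Qed.

Lemma the_unique (T : pointedType) (P : set T) (x : T) : unique P x -> the P = x.
Proof.
move=> ux; have [Px xuniq] := ux.
exact: esym (xuniq _ (thePex (ex_intro _ x ux))).
Qed.

(** * Polynomials restricted to the sphere *)

Section sphere_polynomials.
Variable R : realType.
Implicit Types (p q h : sphere R -> R) (r : nat).

Lemma sphere_poly_lin r a p q :
  sphere_poly r p -> sphere_poly r q -> sphere_poly r (p \+ a \*o q).
Proof.
move=> [P [Pr pP]] [Q [Qr qQ]]; exists (P + a *: Q); split=> [|x].
  rewrite (leq_trans (mpoly.msizeD_le _ _))// geq_max Pr.
  exact: leq_trans (mpoly.msizeZ_le _ _) Qr.
by rewrite mpoly.mevalD mpoly.mevalZ /= pP qQ.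
Qed.

Lemma sphere_polyB r p q :
  sphere_poly r p -> sphere_poly r q -> sphere_poly r (p \- q).
Proof.
move=> Pp Pq; rewrite (_ : p \- q = p \+ -1 \*o q); first exact: sphere_poly_lin.
by apply/funext => x /=; rewrite mulN1r.
Qed.

Lemma sphere_poly0 r : sphere_poly r (cst 0 : sphere R -> R).
Proof. by exists 0; split=> [|x]; rewrite ?mpoly.msize0 ?mpoly.meval0. Qed.

Lemma sphere_poly_sum r (I : finType) (c : I -> R) (P : I -> sphere R -> R) :
  (forall i, sphere_poly r (P i)) -> sphere_poly r (fun x => \sum_i c i * P i x).
Proof.
move=> rP; elim: (index_enum I) => [|i s IHs].
  rewrite (_ : (fun x => _) = cst 0); first exact: sphere_poly0.
  by apply/funext => x; rewrite big_nil.
rewrite (_ : (fun x => _) = (fun x => \sum_(i <- s) c i * P i x) \+ c i \*o P i).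
  exact: sphere_poly_lin.
by apply/funext => x /=; rewrite big_cons addrC.
Qed.

Lemma sphere_poly_leq m r p : (m <= r)%N -> sphere_poly m p -> sphere_poly r p.
Proof. by move=> mr [P [Pm pP]]; exists P; split=> //; exact: leq_trans Pm _. Qed.

Lemma continuous_sphere_val (g : 'rV[R]_3 -> R) :
  continuous g -> continuous (fun x : sphere R => g (sval x)).
Proof.
move=> cg x; apply: (@continuous_comp _ _ _ (@set_val _ (@sphere_set R)) g).
  exact: initial_continuous.
exact: cg.
Qed.

Lemma continuous_sphere_poly r p : sphere_poly r p -> continuous p.
Proof.
move=> [P [_ pP]].
have -> : p = fun x => mpoly.meval (fun i => sval x 0 i) P by exact/funext.
apply: (@continuous_sphere_val (fun v => mpoly.meval (fun i => v 0 i) P)) => v.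
under eq_fun do rewrite mpoly.mevalE.
have fv : Filter (nbhs v) by exact: nbhs_filter.
apply: cvg_big => [|m _]; first exact: add_continuous.
apply: cvgM; first exact: cvg_cst.
apply: cvg_big => [|i _]; first exact: mul_continuous.
apply: (@continuous_comp _ _ _ (fun v : 'rV[R]_3 => v 0 i) (fun y : R => y ^+ m i)).
  exact: coord_continuous.
exact: exprn_continuous.
Qed.

Lemma sphere_coord_le1 (x : sphere R) i : `|sval x 0 i| <= 1.
Proof.
move: (sval x) (svalP x) => v; rewrite inE /sphere_set /= => v1.
rewrite -(expr_le1 (n := 2))// real_normK ?num_real// -v1 (bigD1 i)//= lerDl.
by apply: sumr_ge0 => j _; exact: sqr_ge0.
Qed.

(** Coordinates on the sphere are at most 1 in absolute value, so the absolute values of the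
    coefficients sum to a bound. This will make the Lebesgue constant finite. *)
Lemma sphere_poly_bounded r p :
  sphere_poly r p -> exists B, forall x, `|p x| <= B.
Proof.
move=> [P [_ pP]]; exists (\sum_(m <- mpoly.msupp P) `|mpoly.mcoeff m P|) => x.
rewrite pP mpoly.mevalE (le_trans (ler_norm_sum _ _ _))//.
apply: ler_sum => m _; rewrite normrM ler_piMr// normr_prod.
apply: prodr_ile1 => i _; rewrite normr_ge0 normrX exprn_ile1//.
exact: sphere_coord_le1.
Qed.

End sphere_polynomials.

(** * The L2 and L-infinity norms of continuous functions on the sphere *)

Section sphere_norms.
Variable R : realType.
Implicit Types (h g : sphere R -> R).

Lemma continuous_measurable_sphere h : continuous h -> measurable_fun setT h.
Proof.
move=> /continuousP ch; apply: (measurability _ (RGenOpens.measurableE R)).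
move=> _ [_ [a [b ->] <-]]; rewrite setTI.
by apply: sub_sigma_algebra; apply: ch; exact: interval_open.
Qed.

Lemma continuousB_sphere h g : continuous h -> continuous g -> continuous (h \- g).
Proof. by move=> ch cg x; exact: (continuousB (ch x) (cg x)). Qed.

(** The complement is open and null, hence empty. This turns almost everywhere statements about
    continuous functions into pointwise ones. *)
Lemma ae_closed_sphere (C : set (sphere R)) :
  closed C -> {ae @surface_measure R, forall x, C x} -> forall x, C x.
Proof.
move=> cC aeC x; apply: contrapT => nCx.
have oC : open (~` C) by exact: closed_openC.
have := surface_measure_open_gt0 oC (ex_intro _ x nCx).
have mC : measurable (~` C) by exact: sub_sigma_algebra.
by move/(negligibleP _ mC) : aeC => ->; rewrite ltxx.
Qed.

Lemma surface_measureT_gt0 : (0 < surface_measure [set: sphere R])%E.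
Proof. by rewrite surface_measureT lte_fin mulr_gt0 ?pi_gt0. Qed.

(* Linfnorm is an essential supremum: that it controls the values at individual
   nodes relies on nonempty open sets having positive measure. *)
Lemma le_Linfnorm h x : continuous h -> (`|h x|%:E <= Linfnorm h)%E.
Proof.
move=> ch; have := Lnorm_ge0 (@surface_measure R) +oo%E (EFin \o h).
(* The norm of exponent [+oo] unfolds to an essential supremum only once the total mass is known to
   be positive. *)
rewrite /Linfnorm unlock surface_measureT_gt0.
have := @ess_supP _ _ _ (@surface_measure R) (abse \o (EFin \o h)).
move: (ess_sup _ _) => [L| |] // supP _; last by rewrite leey.
have /supP aeL := lexx L%:E; rewrite lee_fin.
apply: (@ae_closed_sphere [set x | `|h x| <= L]) => //.
rewrite (_ : [set _ | _] = (fun x => `|h x|) @^-1` [set y | y <= L])//.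
have /continuous_closedP : continuous (fun x => `|h x|) by move=> y; exact: (cvg_norm (ch y)).
by apply; exact: closed_le.
Qed.

Lemma L2norm_eq0 h : continuous h -> L2norm h = 0%E -> h = cst 0.
Proof.
move=> ch h0; apply/funext => x.
apply: (@ae_closed_sphere (h @^-1` [set 0])).
  by move/continuous_closedP : ch; apply; exact: closed_eq.
have mh : measurable_fun setT (EFin \o h).
  by apply/measurable_EFinP; exact: continuous_measurable_sphere.
have := Lnorm_eq0_eq0 mh (ltr0Sn _ 1 : (0 < 2%:E :> \bar R)%E) h0.
by apply: filterS => y /(_ Logic.I) [].
Qed.

Lemma L2norm_le h B : continuous h -> (forall x, `|h x| <= B) ->
  (L2norm h <= (Num.sqrt (4 * pi) * B)%:E)%E.
Proof.
move=> ch hB; have B0 : 0 <= B := le_trans (normr_ge0 _) (hB point).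
have mh : measurable_fun setT (EFin \o h).
  by apply/measurable_EFinP; exact: continuous_measurable_sphere.
(* The bound is the L2 norm of the constant [B], so comparing the integrals of the squares
   suffices. *)
have -> : (Num.sqrt (4 * pi) * B)%:E = ((4 * pi * B ^+ 2)%:E `^ 2^-1)%E.
  rewrite poweR_EFin powR12_sqrt ?mulr_ge0 ?pi_ge0 ?sqr_ge0//.
  by rewrite [in RHS]sqrtrM ?mulr_ge0 ?pi_ge0// sqrtr_sqr ger0_norm.
rewrite /L2norm unlock; apply: gt0_ler_poweR.
- by rewrite invr_ge0.
- by rewrite in_itv /= leey andbT integral_ge0.
- by rewrite in_itv /= leey andbT lee_fin ?mulr_ge0 ?pi_ge0 ?sqr_ge0.
have -> : (4 * pi * B ^+ 2)%:E = (\int[@surface_measure R]_x (cst (B ^+ 2)%:E x))%E.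
  by rewrite integral_cst//= surface_measureT -EFinM mulrC.
apply: ge0_le_integral => //.
- by move=> x _; exact: poweR_ge0.
- apply: (@measurableT_comp _ _ _ _ _ _ (fun y => y `^ 2)%E) => //.
    exact: (measurableT_comp (measurable_poweR _)).
  exact: measurableT_comp.
move=> x _; rewrite /= powR_mulrn// lee_fin.
by rewrite ler_sqr ?nnegrE.
Qed.

Lemma L2norm_triangle h g : continuous h -> continuous g ->
  (L2norm h <= L2norm g + L2norm (h \- g))%E.
Proof.
move=> ch cg; rewrite /L2norm.
have {1}-> : h = g \+ (h \- g) by apply/funext => x /=; rewrite addrC subrK.
apply: minkowski_EFin; [exact: continuous_measurable_sphere| |by rewrite ler1n].
exact: continuous_measurable_sphere (continuousB_sphere ch cg).
Qed.

End sphere_norms.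

(** * Lagrange interpolation and the Lebesgue constant *)

Section interpolation.
Variables (R : realType) (K : nat) (xs : 'I_K -> sphere R) (m : nat).
Hypotheses (xs_inj : injective xs) (unisolv : unisolvent xs m).

Lemma interpolantP f : continuous f ->
  sphere_poly m (interpolant xs m f) /\ interpolates xs f (interpolant xs m f).
Proof. by move=> /unisolv; exact: thePex. Qed.

(** Unisolvence is applied to [q] itself, a continuous function that both [p] and [q]
    interpolate. *)
Lemma sphere_poly_interpolation_inj p q :
  sphere_poly m p -> sphere_poly m q -> (forall j, p (xs j) = q (xs j)) -> p = q.
Proof.
move=> mp mq pq; have [s [_ s_uniq]] := unisolv (continuous_sphere_poly mq).
by rewrite -(s_uniq p)// -(s_uniq q).
Qed.

Lemma lagrangeP j :
  sphere_poly m (Defs.lagrange xs m j) /\ forall k, Defs.lagrange xs m j (xs k) = (j == k)%:R.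
Proof.
(* Interpolating g gives the Lagrange polynomial: unisolvence only speaks about
   data that are the node values of a continuous function. *)
pose d k (x : sphere R) : R := `|sval x - sval (xs k)|.
pose g x := \prod_(k | k != j) (d k x / d k (xs j)).
(* At node [j] all factors are 1, their denominators being nonzero by injectivity of [xs]; at
   another node [k] the factor of index [k] vanishes. *)
have gE k : g (xs k) = (j == k)%:R.
  have [<-|jk] := eqVneq j k.
    apply: big1 => i ij; rewrite divff// normr_eq0 subr_eq0.
    by apply: contra ij => /eqP/val_inj/xs_inj ->.
  by rewrite /g (bigD1 k) 1?eq_sym//= /d subrr normr0 mul0r mul0r.
have cg : continuous g.
  apply: (@continuous_sphere_val R (fun v => \prod_(k | k != j)
    (`|v - sval (xs k)| / d k (xs j)))) => v.
  have fv : Filter (nbhs v) by exact: nbhs_filter.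
  apply: cvg_big => [|k _]; first exact: mul_continuous.
  apply: cvgM; last exact: cvg_cst.
  by apply: cvg_norm; apply: cvgB; [exact: cvg_id|exact: cvg_cst].
have [l [[ml lg] l_uniq]] := unisolv cg.
apply: (@thePex _ [set l | sphere_poly m l /\ forall k, l (xs k) = (j == k)%:R]).
exists l; split; first by split=> // k; rewrite lg gE.
by move=> l' [ml' l'E]; apply: l_uniq; split=> // k; rewrite l'E gE.
Qed.

Lemma lagrange_decomposition p : sphere_poly m p ->
  p = fun x => \sum_j p (xs j) * Defs.lagrange xs m j x.
Proof.
move=> mp; apply: sphere_poly_interpolation_inj => // [|k].
  by apply: sphere_poly_sum => j; have [] := lagrangeP j.
rewrite (bigD1 k)//= (lagrangeP k).2 eqxx mulr1 big1 ?addr0// => j jk.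
by rewrite (lagrangeP j).2 (negbTE jk) mulr0.
Qed.

(** Boundedness of the Lagrange polynomials excludes [+oo], and the existence of a point on the
    sphere excludes [-oo]. *)
Lemma lebesgue_constant_real : exists L : R,
  [/\ lebesgue_constant xs m = L%:E, 0 <= L &
      forall x, \sum_j `|Defs.lagrange xs m j x| <= L].
Proof.
have /choice[B lB] j : exists B, forall x, `|Defs.lagrange xs m j x| <= B.
  by have [/sphere_poly_bounded] := lagrangeP j.
have sup_le : (lebesgue_constant xs m <= (\sum_j B j)%:E)%E.
  apply: ge_ereal_sup => _ [x _ <-]; rewrite lee_fin.
  exact: ler_sum.
have le_sup x : ((\sum_j `|Defs.lagrange xs m j x|)%:E <= lebesgue_constant xs m)%E.
  by apply: ereal_sup_ubound; exists x.
move: sup_le le_sup; case: (lebesgue_constant xs m) => [L| |] // _ le_sup.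
  exists L; split=> //.
  by rewrite -lee_fin (le_trans _ (le_sup point))// lee_fin sumr_ge0.
by have := le_sup point.
Qed.

(** Expand [p] in the Lagrange basis and bound each coefficient, a node value, by [B]. *)
Lemma sphere_poly_node_bound p (L B : R) : sphere_poly m p ->
  (forall x, \sum_j `|Defs.lagrange xs m j x| <= L) ->
  (forall j, `|p (xs j)| <= B) -> 0 <= B ->
  forall x, `|p x| <= L * B.
Proof.
move=> mp lL pB B0 x; rewrite (lagrange_decomposition mp).
rewrite (le_trans (ler_norm_sum _ _ _))// (le_trans _ (ler_wpM2r B0 (lL x)))//.
rewrite mulr_suml; apply: ler_sum => j _.
by rewrite normrM mulrC ler_wpM2l.
Qed.

End interpolation.

(** * Normal equations of the constrained least squares problem *)

Section regression.
Variables (R : realType) (N M : nat) (xN : 'I_N -> sphere R) (xM : 'I_M -> sphere R).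
Variables (r : nat) (f : sphere R -> R).

Lemma node_sqr_pythagoras g h : node_inner xN g h = 0 ->
  \sum_i `|g (xN i) + h (xN i)| ^+ 2 =
  \sum_i `|g (xN i)| ^+ 2 + \sum_i `|h (xN i)| ^+ 2.
Proof.
move=> gh; under eq_bigr do rewrite real_normK ?num_real// sqrrD.
under [in RHS]eq_bigr do rewrite real_normK ?num_real//.
under [X in _ = _ + X]eq_bigr do rewrite real_normK ?num_real//.
rewrite !big_split /= -!addrA; congr (_ + _).
by rewrite -/(node_inner xN g h) gh !add0r.
Qed.

Lemma vanishing_polyB p q :
  sphere_poly r p -> interpolates xM f p -> sphere_poly r q -> interpolates xM f q ->
  vanishing_poly xM r (p \- q).
Proof.
move=> rp pf rq qf; split; first exact: sphere_polyB.
by move=> j /=; rewrite pf qf subrr.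
Qed.

(* The vectors of node values of vanishing polynomials form a subspace; project the
   residual of any feasible polynomial onto it. *)
Lemma exists_normal_equations p : sphere_poly r p -> interpolates xM f p ->
  exists p0, [/\ sphere_poly r p0, interpolates xM f p0 &
    forall q, vanishing_poly xM r q -> node_inner xN (f \- p0) q = 0].
Proof.
move=> rp pf; pose row (h : sphere R -> R) : 'rV[R]_N := \row_i h (xN i).
pose W := [set row q | q in vanishing_poly xM r].
have [||w [q [rq q0] <-] orth] := @orthogonal_projection R N W (row (f \- p)).
- exists (cst 0); last by apply/rowP => i; rewrite !mxE.
  by split=> //; exact: sphere_poly0.
- move=> a _ _ [q [rq q0] <-] [s [rs s0] <-]; exists (q \+ a \*o s).
    split; first exact: sphere_poly_lin.
    by move=> j /=; rewrite q0 s0 mulr0 addr0.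
  by apply/rowP => i; rewrite !mxE.
exists (p \+ 1 \*o q); split; first exact: sphere_poly_lin.
  by move=> j /=; rewrite q0 mulr0 addr0 pf.
move=> s Vs; have Ws : W (row s) by exists s.
rewrite -[RHS](orth _ Ws); apply: eq_bigr => i _.
by rewrite !mxE /= mul1r opprD addrA.
Qed.

(** Feasible polynomials differ by a vanishing one, so by Pythagoras the objective at [q] exceeds
    that at [p] by the squared node distance from [p] to [q]. *)
Lemma interpolation_regressionE p :
  sphere_poly r p -> interpolates xM f p ->
  (forall q, vanishing_poly xM r q -> node_inner xN (f \- p) q = 0) ->
  (forall q, sphere_poly r q -> (forall i, q (xN i) = 0) -> q = cst 0) ->
  interpolation_regression xN xM r f = p.
Proof.
move=> rp pf orth xN_inj.
have sqrE q : sphere_poly r q -> interpolates xM f q ->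
    \sum_i `|q (xN i) - f (xN i)| ^+ 2 =
    \sum_i `|p (xN i) - f (xN i)| ^+ 2 + \sum_i `|p (xN i) - q (xN i)| ^+ 2.
  move=> rq qf; under [X in _ = X + _]eq_bigr do rewrite distrC.
  rewrite -(node_sqr_pythagoras (orth _ (vanishing_polyB rp pf rq qf))) /=.
  by apply: eq_bigr => i _; rewrite addrA subrK distrC.
apply: the_unique; split=> [|q [[rq qf] qmin]].
  split=> // q rq qf; rewrite (sqrE q)// lerDl.
  by apply: sumr_ge0 => i _; exact: sqr_ge0.
(* For another minimizer [q] this excess is at most 0, so [p] and [q] agree at all sampling
   nodes. *)
have := qmin p rp pf; rewrite (sqrE q)// gerDl => sum_le0.
have /eqP : \sum_i `|p (xN i) - q (xN i)| ^+ 2 = 0.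
  apply/eqP; rewrite eq_le sum_le0 /=.
  by apply: sumr_ge0 => i _; exact: sqr_ge0.
rewrite psumr_eq0 => [/allP pq|i _]; last exact: sqr_ge0.
suff /funext : p \- q =1 cst 0.
  by move=> pq0; apply/funext => x; apply/eqP; rewrite -subr_eq0 -[_ - _]/((p \- q) x) pq0.
move=> x; rewrite (xN_inj (p \- q))//; first exact: sphere_polyB.
move=> i; have := pq i (mem_index_enum _).
by rewrite /= sqrf_eq0 normr_eq0 => /eqP.
Qed.

End regression.

(** * Orthogonality, Pythagorean identity and error bound for the approximant *)

Theorem theorem9 (R : realType) (m r n : nat)
    (xN : 'I_(n.+1 ^ 2) -> sphere R) (xM : 'I_(m.+1 ^ 2) -> sphere R)
    (alpha : R) (f : sphere R -> R) :
  (m < r)%N -> (r < n)%N ->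
  injective xN -> injective xM -> (forall j, exists i, xM j = xN i) ->
  unisolvent xM m ->
  0 < alpha ->
  (forall p, sphere_poly r p ->
    (alpha%:E * L2norm p ^+ 2 <=
      ((n.+1 ^ 2)%N%:R^-1 * \sum_(i < (n.+1 ^ 2)%N) `|p (xN i)| ^+ 2)%:E)%E) ->
  continuous f ->
  let pm := interpolant xM m f in
  let phat := interpolation_regression xN xM r f in
  [/\ forall q, vanishing_poly xM r q ->
        node_inner xN ((f \- pm) \- (phat \- pm)) q = 0,
      node_norm xN (f \- phat) ^+ 2 + node_norm xN (phat \- pm) ^+ 2 =
        node_norm xN (f \- pm) ^+ 2
    & (L2norm (f \- phat) <=
        (Num.sqrt (4 * pi) + (Num.sqrt alpha)^-1)%:E *
        (1 + lebesgue_constant xM m) *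
        ereal_inf [set Linfnorm (f \- q) | q in sphere_poly m])%E ].
Proof.
move=> mr _ _ xM_inj _ unisolv alpha0 sampling cf pm phat.
have [mpm pmf] : sphere_poly m pm /\ interpolates xM f pm by exact: interpolantP.
have rpm : sphere_poly r pm := sphere_poly_leq (ltnW mr) mpm.
have N0 : 0 < (n.+1 ^ 2)%N%:R :> R by rewrite ltr0n expn_gt0.
(* The sampling inequality after clearing the average and taking square roots. *)
have sampling_bound p D : sphere_poly r p -> 0 <= D ->
    \sum_i `|p (xN i)| ^+ 2 <= (n.+1 ^ 2)%N%:R * D ^+ 2 ->
    (L2norm p <= ((Num.sqrt alpha)^-1 * D)%:E)%E.
  move=> rp D0 pD.
  have {pD} pD : (alpha%:E * L2norm p ^+ 2 <= (D ^+ 2)%:E)%E.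
    by rewrite (le_trans (sampling p rp))// lee_fin ler_pdivrMl.
  have : (0 <= L2norm p)%E by exact: Lnorm_ge0.
  (* An infinite norm would make the left side infinite, against the finite bound. *)
  move: pD; case: (L2norm p) => [t| |] //; last first.
    by rewrite expe2 mulyy mulry gtr0_sg// mul1e leye_eq.
  rewrite -EFin_expe -EFinM !lee_fin => tD t0; rewrite ler_pdivlMl ?sqrtr_gt0//.
  rewrite -ler_sqr ?nnegrE ?mulr_ge0 ?sqrtr_ge0//.
  by rewrite exprMn sqr_sqrtr// ltW.
(* Definiteness of the node inner product: the case [D = 0] of the bound. *)
have xN_inj p : sphere_poly r p -> (forall i, p (xN i) = 0) -> p = cst 0.
  move=> rp p0; apply: L2norm_eq0; first exact: continuous_sphere_poly rp.
  have /(_ (lexx 0)) := sampling_bound p 0 rp.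
  rewrite mulr0 expr0n mulr0 big1 => [/(_ (lexx 0)) p_le0|i _]; last first.
    by rewrite p0 normr0 expr0n.
  by apply/eqP; rewrite eq_le p_le0 Lnorm_ge0.
(* Since [m < r], [pm] is feasible; a solution of the normal equations is built from it and then
   identified with [phat]. *)
have [rphat phatf orth] : [/\ sphere_poly r phat, interpolates xM f phat &
    forall q, vanishing_poly xM r q -> node_inner xN (f \- phat) q = 0].
  have [p [rp pf orth]] := exists_normal_equations xN rpm pmf.
  by rewrite /phat (interpolation_regressionE rp pf orth xN_inj).
have pythagoras : \sum_i `|f (xN i) - phat (xN i)| ^+ 2 +
    \sum_i `|phat (xN i) - pm (xN i)| ^+ 2 = \sum_i `|f (xN i) - pm (xN i)| ^+ 2.
  rewrite -(node_sqr_pythagoras (orth _ (vanishing_polyB rphat phatf rpm pmf))).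
  by apply: eq_bigr => i _ /=; rewrite addrA subrK.
split.
- move=> q Vq; rewrite -[RHS](orth q Vq); apply: eq_bigr => i _ /=.
  by rewrite opprB addrA subrK.
- by rewrite /node_norm !sqr_sqrtr ?sumr_ge0// => i _; exact: sqr_ge0.
have [L [-> L0 lL]] := lebesgue_constant_real xM_inj unisolv.
(* Positivity of the constant allows moving it inside the infimum, so that each [q] can be treated
   separately. *)
have c_gt0 : 0 < (Num.sqrt (4 * pi) + (Num.sqrt alpha)^-1) * (1 + L).
  by rewrite mulr_gt0 ?(ltr_pwDl ltr01)// ltr_pwDr ?sqrtr_ge0// invr_gt0 sqrtr_gt0.
rewrite -EFinD -EFinM -ereal_inf_pZl//.
apply: le_ereal_inf_tmp => _ [_ [q mq <-] <-].
have cfq : continuous (f \- q) := continuousB_sphere cf (continuous_sphere_poly mq).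
have := @le_Linfnorm _ _ _ cfq; have : (0 <= Linfnorm (f \- q))%E by exact: Lnorm_ge0.
case: (Linfnorm (f \- q)) => [e| |] //; last first.
  by move=> _ _; rewrite gt0_muley ?leey// lte_fin.
rewrite lee_fin => e0 fqe.
have fpm x : `|f x - pm x| <= (1 + L) * e.
  rewrite mulrDl mul1r (_ : f x - pm x = (f x - q x) - (pm x - q x)); last first.
    by rewrite opprB addrA subrK.
  rewrite (le_trans (ler_normB _ _))// lerD//; first exact: fqe.
  have -> : pm x - q x = (pm \- q) x by [].
  apply: (sphere_poly_node_bound xM_inj unisolv _ lL) => // [|j].
    exact: sphere_polyB.
  by rewrite /= pmf; exact: fqe.
have cfpm : continuous (f \- pm) := continuousB_sphere cf (continuous_sphere_poly mpm).
have De0 : 0 <= (1 + L) * e by rewrite mulr_ge0 ?addr_ge0.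
rewrite (le_trans (L2norm_triangle (continuousB_sphere cf (continuous_sphere_poly rphat)) cfpm))//.
rewrite -EFinM -mulrA mulrDl EFinD leeD//; first exact: L2norm_le.
rewrite (_ : _ \- _ = pm \- phat); last first.
  by apply/funext => x /=; rewrite opprB addrC addrA subrK.
apply: sampling_bound => //; first exact: sphere_polyB.
apply: (@le_trans _ _ (\sum_i `|f (xN i) - pm (xN i)| ^+ 2)).
  rewrite -pythagoras; under eq_bigr do rewrite distrC.
  by rewrite lerDr; apply: sumr_ge0 => i _; exact: sqr_ge0.
(* The pointwise bound is summed over all sampling nodes; the resulting factor [n.+1 ^ 2] is the one
   allowed in [sampling_bound]. *)
apply: (@le_trans _ _ (\sum_(i < n.+1 ^ 2) ((1 + L) * e) ^+ 2)).
  by apply: ler_sum => i _; rewrite ler_sqr ?nnegrE.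
by rewrite sumr_const card_ord mulr_natl.
Qed.
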